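(* Let $C_1:=\inf_{s\ge 1}p_{1,s}$, the infimum being over positive integers $s$. Then $$C_1=p_{1,2}=\frac{\log 4}{\log 6}=:p_0.$$ Consequently, for every integer $L\ge 0$ and every $0\le t\le 1$, $$G_{L+1}(t^{p_0})\ge\bigl((1+t)\,G_L(t)\bigr)^{p_0}.$$
   Context: For an integer $n\ge 0$ and $0\le t\le 1$, put $G_n(t):=1+t+\cdots+t^n$. For positive integers $r,s$, a real number $p>0$ is called admissible for $(r,s)$ if $$G_{r+s}(t^p)\ge G_r(t)^p\,G_s(t)^p\qquad\text{for all }0\le t\le 1,$$ and $p=0$ is declared admissible as well. $p_{r,s}$ denotes the largest admissible exponent for $(r,s)$ (it exists: the set of admissible exponents is a closed bounded interval $[0,p_{r,s}]$). *)

(* Defs.v *)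
From HB Require Import structures.
From mathcomp Require Import all_boot all_order all_algebra.
From mathcomp Require Import all_classical all_reals all_analysis.
Set Implicit Arguments.
Unset Strict Implicit.
Unset Printing Implicit Defensive.
Import Order.TTheory GRing.Theory Num.Theory.
Import numFieldNormedType.Exports.
Local Open Scope classical_set_scope.
Local Open Scope ring_scope.

Definition G {R : realType} (n : nat) (t : R) : R := \sum_(0 <= i < n.+1) t ^+ i.

Definition admissible {R : realType} (r s : nat) (p : R) : Prop :=
  p = 0 \/
  (0 < p /\
   forall t : R, 0 <= t <= 1 -> G r t `^ p * G s t `^ p <= G (r + s) (t `^ p)).

(* [sup] returns 0 on an unbounded set and need not belong to the set;
   [largest_exponentP] below shows that this is the maximum. *)
Definition largest_exponent (R : realType) (r s : nat) : R :=
  sup [set p : R | admissible r s p].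

Lemma G_ge1 (R : realType) n (t : R) : 0 <= t -> 1 <= G n t.
Proof.
move=> t0; rewrite /G big_nat_recl // expr0 lerDl sumr_ge0 // => i _.
exact: exprn_ge0.
Qed.

Lemma G1 (R : realType) n : G n (1 : R) = n.+1%:R.
Proof.
rewrite /G (eq_bigr (fun=> 1)) => [|i _]; last by rewrite expr1n.
by rewrite sumr_const_nat subn0.
Qed.

Lemma admissible_le1 (R : realType) r s (p : R) : (0 < r)%N -> (0 < s)%N ->
  admissible r s p -> p <= 1.
Proof.
move=> r0 s0 [->|[p0 /(_ 1)]]; first exact: ler01.
rewrite ler01 lexx powR1 !G1 -powRM // -natrM => /(_ isT) H.
rewrite leNgt; apply/negP => p1.
have : (r.+1 * s.+1)%:R <= (r.+1 * s.+1)%:R `^ p :> R.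
  by rewrite -[X in X <= _]powRr1 // ler_powR ?ler1n ?muln_gt0 // ltW.
move/le_trans => /(_ _ H); rewrite ler_nat leqNgt => /negP; apply.
have -> : (r.+1 * s.+1 = (r + s).+1 + r * s)%N.
  by rewrite mulSn mulnS !addSn addnA (addnC s).
by rewrite -[X in (X < _)%N]addn0 ltn_add2l muln_gt0 r0.
Qed.

Lemma largest_exponentP (R : realType) r s : (0 < r)%N -> (0 < s)%N ->
  admissible r s (largest_exponent R r s) /\
  forall p : R, admissible r s p -> p <= largest_exponent R r s.
Proof.
move=> r0 s0; set A := [set p : R | admissible r s p].
have A_sup : has_sup A.
  by split; [exists 0; left|exists 1 => p; exact: admissible_le1].
split=> [|p Ap]; last exact: (ub_le_sup A_sup.2).
rewrite /largest_exponent -/A; set q := sup A.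
have : 0 <= q by apply: (ub_le_sup A_sup.2); left.
rewrite le_eqVlt => /predU1P[<-|q0]; first by left.
right; split=> // t /andP[t0 t1].
have := t0; rewrite le_eqVlt => /predU1P[<-|tp].
  rewrite powR0 ?gt_eqF // /G !big_nat_recl //= !expr0.
  by rewrite !big1 ?addr0 ?powR1 ?mulr1// => i _; rewrite exprS mul0r.
have Gp n : 0 < G n t by exact: lt_le_trans (G_ge1 n t0).
have powc (a : R) : 0 < a -> continuous (fun p : R => a `^ p).
  move=> a0 p; rewrite /powR gt_eqF //.
  apply: continuous_comp; last exact: continuous_expR.
  by apply: cvgM; [exact: cvg_id|exact: cvg_cst].
rewrite leNgt; apply/negP => lt_q.
pose f p := G r t `^ p * G s t `^ p - G (r + s) (t `^ p).
have fc : {for q, continuous f}.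
  rewrite /f; apply: cvgB; first by apply: cvgM; exact: powc.
  apply: cvg_big => [|i _]; first exact: add_continuous.
  exact: (continuous_comp (powc _ tp q) (@exprn_continuous R i _)).
have fq : 0 < f q by rewrite subr_gt0.
have : \forall p \near q, 0 < f p by exact: (cvgr_gt (f q) fc).
move/nbhs_ballP => [e /= e0 He].
have m0 : 0 < Num.min e q by rewrite lt_min e0.
have [p Ap qep] := sup_adherent m0 A_sup.
have pq : p <= q by exact: (ub_le_sup A_sup.2).
have : 0 < f p.
  apply: He; rewrite /ball /= ger0_norm ?subr_ge0 // ltrBlDr -ltrBlDl.
  by apply: le_lt_trans qep; rewrite lerB // ge_min lexx.
rewrite subr_gt0 ltNge => /negP; apply.
case: Ap => [p0|[_]]; last by apply; rewrite t0.
by move: qep; rewrite p0 subr_lt0 lt_min ltxx andbF.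
Qed.

(* Main.v *)
Require Import Defs.
From mathcomp Require Import all_boot all_order all_algebra.
From mathcomp Require Import all_classical all_reals all_analysis.
From mathcomp Require Import ring lra.
Set Implicit Arguments.
Unset Strict Implicit.
Unset Printing Implicit Defensive.
Import Order.TTheory GRing.Theory Num.Theory.
Import numFieldNormedType.Exports.
Local Open Scope classical_set_scope.
Local Open Scope ring_scope.

(** Put [q = ln 6 / ln 4], so that [p0 = 1 / q] and [4 `^ q = 6]. With
[z = t `^ p0], that is [t = z `^ q], the inequality
[((1 + t) * G s t) `^ p0 <= G s.+1 (t `^ p0)] becomes
[(1 + z `^ q) * G s (z `^ q) <= G s.+1 z `^ q], called [product_bound q s]
below. At [z = 1] it reads [2 (s + 1) <= (s + 2) `^ q], which is an equality
for [s = 2]; this is what forces the value [p0] (evaluate admissibility for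
(1, 2) at [t = 1]). Once [product_bound q s] holds for all [s], the exponent
[p0] is admissible for every pair (1, s), so it is at most every [p_{1,s}], and
it equals [p_{1,2}], which is therefore the infimum.

For large [s] the bound propagates by induction: passing from [s] to [s + 1]
adds [(1 + z `^ q) z `^ (q n)], [n = s + 1], on the left, and convexity of the
power makes the right side grow by at least
[q z ^+ n.+1 * G n z `^ (q - 1)], which is enough as soon as [n >= 4]
([increment_bound]). For [n <= 3] it is not enough, already at [z = 1], so the
cases [s = 1, 2, 3] need a direct argument (the case [s = 0] is immediate).

In these cases substitute [z = exp (-2 t)] and study on [t >= 0] the
function [k t = ln ((1 + z `^ q) * G s (z `^ q)) - q * ln (G s.+1 z)]. One has
[k 0 <= 0], and [k <= 0] for arbitrarily large [t]; so [k <= 0] everywhere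
provided that [k], once positive, remains positive. That property passes from a
derivative to its primitive when the primitive is nonpositive at 0
([stays_positive_primitive]), so it is enough to have it for [k'].
Up to a positive factor, [k'] is a sum of terms [c sinh (theta t)] with ten
terms at most. Differentiating such a sum twice multiplies each [c] by
[theta ^+ 2], and the values at 0 of its odd derivatives are the odd moments
[\sum c theta ^+ m]. In all three cases these moments are negative for the
first few odd [m] and positive afterwards, and in a high enough derivative the
largest frequency dominates all the negative terms; integrating back gives the
required property. The moments are polynomials in [q], whose signs follow from
[84 / 65 <= q <= 22 / 17]. *)

(** * Propagation of signs from a derivative to its primitive *)

Lemma MVT_derive (R : realType) (f df : R -> R) (a b : R) : a <= b ->
  (forall x : R, is_derive x 1 f (df x)) ->
  exists2 c, a <= c <= b & f b - f a = df c * (b - a).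
Proof.
move=> ab fdf; have fc : {within `[a, b], continuous f}.
  apply: continuous_in_subspaceT => x _; apply: differentiable_continuous.
  by apply/derivable1_diffP; case: (fdf x).
have [c] := MVT_segment ab (fun x _ => fdf x) fc.
by rewrite in_itv /= => cab eqf; exists c.
Qed.

Definition stays_positive (R : realType) (f : R -> R) :=
  forall a b, 0 <= a -> a <= b -> 0 < f a -> 0 < f b.

(** A positive value [f a] is a rise from [f 0 <= 0], so [df] is positive at
some point before [a], hence everywhere after it, and [f] only increases past
[a]. *)
Lemma stays_positive_primitive (R : realType) (f df : R -> R) :
  (forall x : R, is_derive x 1 f (df x)) -> f 0 <= 0 ->
  stays_positive df -> stays_positive f.
Proof.
move=> fdf f0 pdf a b a0 ab fa.
have [c /andP[c0 ca] fE] := MVT_derive a0 fdf.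
have dfc : 0 < df c.
  rewrite ltNge; apply/negP => dfc.
  have : df c * (a - 0) <= 0 by rewrite mulr_le0_ge0 // subr0.
  by rewrite -fE; lra.
have [d /andP[ad _] fE'] := MVT_derive ab fdf.
have dfd : 0 < df d by apply: pdf dfc => //; exact: le_trans ad.
have : 0 <= df d * (b - a) by rewrite mulr_ge0 ?subr_ge0 // ltW.
by rewrite -fE'; lra.
Qed.

Lemma ge0_primitive (R : realType) (f df : R -> R) :
  (forall x : R, is_derive x 1 f (df x)) -> 0 <= f 0 ->
  (forall x, 0 <= x -> 0 <= df x) -> forall x, 0 <= x -> 0 <= f x.
Proof.
move=> fdf f0 df0 x x0; have [c /andP[c0 _] fE] := MVT_derive x0 fdf.
have : 0 <= df c * (x - 0) by rewrite mulr_ge0 ?df0 // subr0.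
by rewrite -fE; lra.
Qed.

(** * Sums of exponentials and of hyperbolic sines *)

(** The [m]-th derivative of the exponential sum whose (coefficient, frequency)
pairs are listed in [l]. Keeping [m] as a parameter lets one list describe a sum
together with all its derivatives. *)
Definition expsum (R : realType) (l : seq (R * R)) (m : nat) (t : R) : R :=
  \sum_(p <- l) p.1 * p.2 ^+ m * expR (p.2 * t).

Lemma is_derive_expsum (R : realType) (l : seq (R * R)) m (t : R) :
  is_derive t 1 (expsum l m) (expsum l m.+1 t).
Proof.
elim: l => [|p l IH].
  have -> : expsum [::] m = cst (0 : R).
    by apply/funext => y; rewrite /expsum big_nil.
  by rewrite /expsum big_nil; exact: is_derive_cst.
have -> : expsum (p :: l) m =
    (fun y => p.1 * p.2 ^+ m * expR (p.2 * y)) + expsum l m.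
  by apply/funext => y; rewrite /expsum big_cons.
rewrite /expsum big_cons -/(expsum l m.+1 t); apply: is_deriveD.
have dlin : is_derive t 1 (fun y => p.2 * y) p.2.
  apply: (@is_derive_eq _ _ _ (p.2 \*: (id : R -> R))).
  by rewrite /GRing.scale /= mulr1.
have := is_derive1_comp (is_derive_expR (p.2 * t)) dlin.
move/(is_deriveZ (p.1 * p.2 ^+ m)) => /is_derive_eq; apply.
by rewrite /GRing.scale /= exprSr; ring.
Qed.

(** If [l] lists the pairs (c, theta), this lists the exponentials of the sum of
the [2 c sinh (theta t)]. *)
Definition odd_part (R : realType) (l : seq (R * R)) :=
  l ++ [seq (- p.1, - p.2) | p <- l].

Lemma expsum_odd_part (R : realType) (l : seq (R * R)) m (t : R) :
  expsum (odd_part l) m t = \sum_(p <- l)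
    p.1 * p.2 ^+ m * (expR (p.2 * t) - (-1) ^+ m * expR (- (p.2 * t))).
Proof.
rewrite /expsum /odd_part big_cat big_map /= -big_split /=.
apply: eq_bigr => p _.
rewrite (exprNn p.2) (mulNr p.2).
by move: ((-1) ^+ m) (p.2 ^+ m) => a b; ring.
Qed.

(** The derivatives at 0 of the sum listed by [odd_part l] vanish in even order,
and are twice these moments in odd order. *)
Definition moment (R : realType) (l : seq (R * R)) m : R :=
  \sum_(p <- l) p.1 * p.2 ^+ m.

Lemma expsum_odd_part0 (R : realType) (l : seq (R * R)) m :
  expsum (odd_part l) m 0 = moment l m *+ (if odd m then 2 else 0).
Proof.
rewrite expsum_odd_part /moment -sumrMnl; apply: eq_bigr => p _.
rewrite mulr0 oppr0 expR0 mulr1 -signr_odd.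
by case: (odd m) => /=; rewrite ?expr0 ?expr1 ?mulr0n ?mulr2n; ring.
Qed.

(** Two integrations: the even derivative vanishes at 0, and the sign of the odd
one in between is that of a moment. *)
Lemma stays_positive_step (R : realType) (l : seq (R * R)) m :
  ~~ odd m -> moment l m.+1 <= 0 ->
  stays_positive (expsum (odd_part l) m.+2) ->
  stays_positive (expsum (odd_part l) m).
Proof.
move=> mE l0 pos; apply: (stays_positive_primitive (is_derive_expsum _ m)).
  by rewrite expsum_odd_part0 (negbTE mE) mulr0n.
apply: (stays_positive_primitive (is_derive_expsum _ m.+1)) pos.
by rewrite expsum_odd_part0 /= mE mulr2n; lra.
Qed.

Lemma ge0_step (R : realType) (l : seq (R * R)) m :
  ~~ odd m -> 0 <= moment l m.+1 ->
  (forall t, 0 <= t -> 0 <= expsum (odd_part l) m.+3 t) ->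
  forall t, 0 <= t -> 0 <= expsum (odd_part l) m.+1 t.
Proof.
move=> mE l0 ge.
apply: (ge0_primitive (is_derive_expsum _ m.+1)).
  by rewrite expsum_odd_part0 /= mE mulr2n; lra.
apply: (ge0_primitive (is_derive_expsum _ m.+2)) ge.
by rewrite expsum_odd_part0 /= mE.
Qed.

Lemma stays_positive_ge0 (R : realType) (l : seq (R * R)) m :
  (forall t, 0 <= t -> 0 <= expsum (odd_part l) m.+1 t) ->
  stays_positive (expsum (odd_part l) m).
Proof.
move=> ge a b a0 ab /lt_le_trans; apply.
have [d /andP[ad _] fE] := MVT_derive ab (is_derive_expsum (odd_part l) m).
have : 0 <= expsum (odd_part l) m.+1 d * (b - a).
  by rewrite mulr_ge0 ?subr_ge0 // ge // (le_trans a0).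
by rewrite -fE subr_ge0.
Qed.

(** Up to a factor 2, this says that [cosh] increases with the absolute value of
its argument. *)
Lemma cosh_le (R : realType) (y z : R) : `|y| <= z ->
  expR y + expR (- y) <= expR z + expR (- z).
Proof.
wlog y0 : y / 0 <= y => [H|].
  have [|/ltW yn] := leP 0 y; first exact: H.
  by move=> yz; rewrite addrC -{2}(opprK y) H ?normrN // oppr_ge0.
rewrite ger0_norm // => yz.
have ez : expR y <= expR z by rewrite ler_expR.
have ey : 1 <= expR y by rewrite -expR0 ler_expR.
rewrite !expRN -subr_ge0.
have -> : expR z + (expR z)^-1 - (expR y + (expR y)^-1) =
   (expR z - expR y) * (1 - (expR z * expR y)^-1).
  by field; rewrite !gt_eqF ?expR_gt0.
rewrite mulr_ge0 ?subr_ge0 // invf_le1 ?mulr_gt0 ?expR_gt0 //.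
by rewrite -[1]mulr1 ler_pM // (le_trans ey).
Qed.

(** An odd derivative is a sum of terms [2 c theta ^+ m cosh (theta t)]. If the
frequency [z] is the largest, its [cosh] bounds all the others, so it is enough
that its coefficient outweighs the negative coefficients at [t = 0]. *)
Lemma dominated_ge0 (R : realType) (c z : R) (pos neg : seq (R * R)) m :
  odd m -> 0 <= z ->
  all (fun p => 0 <= p.1 * p.2 ^+ m) pos ->
  all (fun p => (p.1 * p.2 ^+ m <= 0) && (`|p.2| <= z)) neg ->
  0 <= c * z ^+ m + moment neg m ->
  forall t, 0 <= t -> 0 <= expsum (odd_part ((c, z) :: pos ++ neg)) m t.
Proof.
move=> mo z0 /allP hpos /allP hneg dom t t0.
rewrite expsum_odd_part big_cons big_cat /= -signr_odd mo expr1.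
under eq_bigr do rewrite mulN1r opprK.
under [X in _ + (_ + X)]eq_bigr do rewrite mulN1r opprK.
rewrite mulN1r opprK; set C := expR (z * t) + _.
have Cge : 0 <= C by rewrite addr_ge0 ?expR_ge0.
have pos0 : 0 <= \sum_(p <- pos)
    p.1 * p.2 ^+ m * (expR (p.2 * t) + expR (- (p.2 * t))).
  rewrite big_seq sumr_ge0 // => p /hpos p0.
  by rewrite mulr_ge0 // addr_ge0 ?expR_ge0.
have neg0 : moment neg m * C <= \sum_(p <- neg)
    p.1 * p.2 ^+ m * (expR (p.2 * t) + expR (- (p.2 * t))).
  rewrite /moment mulr_suml big_seq [leRHS]big_seq ler_sum // => p /hneg.
  move=> /andP[p0 pz]; rewrite ler_wnM2l // cosh_le // normrM (ger0_norm t0).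
  by rewrite ler_wpM2r.
have : 0 <= (c * z ^+ m + moment neg m) * C by rewrite mulr_ge0.
by rewrite mulrDl; lra.
Qed.

(** * Reduction of the product bound to a sign property of a Wronskian *)

Definition product_bound (R : realType) (q : R) (s : nat) := forall z : R,
  0 < z <= 1 -> (1 + z `^ q) * G s (z `^ q) <= G s.+1 z `^ q.

(** The exponential sum of [y ^+ d * G n y] for [y = exp (- 2 c t)]. The factor
2 makes all the frequencies met later integer combinations of 1 and [q]. *)
Definition geometric_terms (R : realType) (c : R) (n d : nat) : seq (R * R) :=
  [seq (1, - ((2 * (i + d))%:R * c)) | i <- iota 0 n.+1].

Lemma expsum_geometric_terms (R : realType) (c : R) n d (t : R) :
  expsum (geometric_terms c n d) 0 t =
  expR (- (2 * c * t)) ^+ d * G n (expR (- (2 * c * t))).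
Proof.
rewrite /expsum big_map /G mulr_sumr -[iota 0 _]/(index_iota 0 n.+1).
apply: eq_bigr => i _ /=.
by rewrite expr0 mulr1 mul1r -exprD -expRM_natl addnC natrM; congr expR; ring.
Qed.

Lemma is_derive_ln (R : realType) (f : R -> R) (x df : R) : 0 < f x ->
  is_derive x 1 f df -> is_derive x 1 (fun y => ln (f y)) (df / f x).
Proof.
move=> fx0 fdf; have := is_derive1_comp (is_derive1_ln fx0) fdf.
by rewrite mulrC.
Qed.

Lemma G_le (R : realType) n (u : R) : 0 <= u <= 1 -> G n u <= 1 + n%:R * u.
Proof.
case/andP=> u0 u1; rewrite /G big_nat_recl // expr0 lerD2l.
apply: le_trans (_ : \sum_(0 <= i < n) u <= _); last first.
  by rewrite sumr_const_nat subn0 mulr_natl.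
by apply: ler_sum => i _; rewrite exprS ler_piMr // exprn_ile1.
Qed.

Lemma G_gt0 (R : realType) n (u : R) : 0 <= u -> 0 < G n u.
Proof. by move=> u0; exact: lt_le_trans (G_ge1 n u0). Qed.

Section LogDerivative.
Variables (R : realType) (q : R) (s : nat).
Let la := geometric_terms (1 : R) s.+1 0.
Let lb := geometric_terms q s 0 ++ geometric_terms q s 1.

(** Writing [A] and [B] for the sums listed by [la] and [lb], this is
[B' A - q A' B], which has the sign of the derivative of [ln B - q ln A]. *)
Definition wronskian (t : R) : R :=
  expsum lb 1 t * expsum la 0 t - q * expsum la 1 t * expsum lb 0 t.

Let x (t : R) : R := expR (- (2 * 1 * t)).
Let u (t : R) : R := expR (- (2 * q * t)).

Let laE t : expsum la 0 t = G s.+1 (x t).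
Proof. by rewrite expsum_geometric_terms expr0 mul1r. Qed.

Let lbE t : expsum lb 0 t = (1 + u t) * G s (u t).
Proof.
rewrite /expsum big_cat /= -!/(expsum _ 0 t) !expsum_geometric_terms.
by rewrite expr0 expr1 -/(u t); ring.
Qed.

Let la_gt0 t : 0 < expsum la 0 t.
Proof. by rewrite laE G_gt0 // expR_ge0. Qed.

Let lb_gt0 t : 0 < expsum lb 0 t.
Proof.
by rewrite lbE mulr_gt0 ?G_gt0 ?expR_ge0 // addr_gt0 // expR_gt0.
Qed.

Let k (t : R) : R := ln (expsum lb 0 t) - q * ln (expsum la 0 t).

Let is_derive_k (t : R) :
  is_derive t 1 k (wronskian t / (expsum la 0 t * expsum lb 0 t)).
Proof.
have db := is_derive_ln (lb_gt0 t) (is_derive_expsum lb 0 t).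
have da := is_derive_ln (la_gt0 t) (is_derive_expsum la 0 t).
have := is_deriveB db (is_deriveZ q da) => /is_derive_eq; apply.
rewrite /wronskian /GRing.scale /=; field.
by rewrite !gt_eqF.
Qed.

(* For large [t], [B <= 1 + (2 s + 1) u] while [A `^ q >= A >= 1 + x], and
   [u / x = exp (- 2 (q - 1) t)] tends to 0. *)
Let k_tail T : 1 < q -> exists2 t, T <= t & k t <= 0.
Proof.
move=> q1; pose K : R := s.*2.+1%:R.
have [t [Tt t0 tK]] : exists t, [/\ T <= t, 0 <= t & K / (2 * (q - 1)) <= t].
  exists (Num.max T (K / (2 * (q - 1)))).
  split; rewrite le_max ?lexx ?orbT //.
  by rewrite divr_ge0 ?orbT // mulr_ge0 // subr_ge0 ltW.
exists t => //.
have x1 : x t <= 1.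
  by rewrite /x -[leRHS]expR0 ler_expR; lra.
have u1 : u t <= 1.
  by rewrite /u -[leRHS]expR0 ler_expR oppr_le0 !mulr_ge0 //; lra.
have Ku : K * u t <= x t.
  have -> : x t = expR (2 * (q - 1) * t) * u t.
    by rewrite /x /u -expRD; congr expR; ring.
  rewrite ler_wpM2r ?expR_ge0 // (le_trans _ (expR_ge1Dx _)) //.
  by move: tK; rewrite ler_pdivrMr ?mulr_gt0 ?subr_gt0 // mulrC; lra.
rewrite /k subr_le0 -ln_powR ler_ln ?posrE ?powR_gt0 // laE lbE.
have u0 : 0 <= u t by exact: expR_ge0.
have Gx : 1 + x t <= G s.+1 (x t).
  rewrite /G big_nat_recl // big_nat_recl // expr0 expr1 addrA lerDl.
  by rewrite sumr_ge0 // => i _; rewrite exprn_ge0 ?expR_ge0.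
have {}Gx : 1 + x t <= G s.+1 (x t) `^ q.
  apply: (le_trans Gx); rewrite -[leLHS]powRr1 ?(ltW (G_gt0 _ _)) ?expR_ge0 //.
  by rewrite ler_powR ?G_ge1 ?expR_ge0 // ltW.
apply: le_trans Gx; apply: le_trans (_ : 1 + K * u t <= _); last lra.
have /(ler_wpM2l (_ : 0 <= 1 + u t)) : G s (u t) <= 1 + s%:R * u t.
  by rewrite G_le // u0 u1.
move/(_ (addr_ge0 ler01 u0))/le_trans; apply.
have : s%:R * u t * u t <= s%:R * u t by rewrite ler_piMr // mulr_ge0.
by rewrite /K -addn1 -addnn !natrD; lra.
Qed.

(** The function [ln B - q ln A] cannot become positive: it would remain so, but
it is nonpositive at arbitrarily large arguments. *)
Lemma product_le_powR : 1 < q -> 2 * s.+1%:R <= s.+2%:R `^ q ->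
  stays_positive wronskian ->
  product_bound q s.
Proof.
move=> q1 q0 pos.
have kpos : stays_positive k.
  apply: (stays_positive_primitive is_derive_k).
    rewrite /k subr_le0 -ln_powR ler_ln ?posrE ?powR_gt0 // laE lbE.
    by rewrite /x /u !mulr0 oppr0 expR0 !G1.
  move=> a b a0 ab; rewrite !pmulr_lgt0 ?invr_gt0 ?mulr_gt0 //; exact: pos.
have k_le0 t : 0 <= t -> k t <= 0.
  move=> t0; rewrite leNgt; apply/negP => kt.
  by have [b tb] := k_tail t q1; rewrite leNgt (kpos _ _ t0 tb kt).
move=> z /andP[z0 z1]; pose t := - (ln z / 2).
have xt : x t = z by rewrite /x /t -[RHS](lnK z0); congr expR; field.
have ut : u t = z `^ q.
  by rewrite /u /t /powR gt_eqF //; congr expR; field.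
have /k_le0 : 0 <= t by rewrite /t oppr_ge0 pmulr_lle0 ?invr_gt0 ?ln_le0.
rewrite /k subr_le0 -ln_powR ler_ln ?posrE ?powR_gt0 // laE lbE.
by rewrite xt ut.
Qed.

End LogDerivative.

(** * The Wronskians for s = 1, 2, 3 as sums of hyperbolic sines *)

Lemma stays_positive_wronskian (R : realType) (q : R) s (l : seq (R * R)) :
  0 < q ->
  (forall t, wronskian q s t =
    2 * q * (expR (q * t) * expR t) ^- s.+1 * expsum (odd_part l) 0 t) ->
  stays_positive (expsum (odd_part l) 0) -> stays_positive (wronskian q s).
Proof.
move=> q0 wE pos a b a0 ab.
have fac t : 0 < 2 * q * (expR (q * t) * expR t) ^- s.+1.
  by rewrite mulr_gt0 ?mulr_gt0 ?invr_gt0 ?exprn_gt0 // mulr_gt0 ?expR_gt0.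
by rewrite !wE !(pmulr_rgt0 _ (fac _)); exact: pos.
Qed.

Lemma expR_linD (R : realType) (q t : R) (a b : nat) :
  expR ((a%:R * q + b%:R) * t) = expR (q * t) ^+ a * expR t ^+ b.
Proof. by rewrite mulrDl -mulrA expRD !expRM_natl. Qed.

Lemma expR_linB (R : realType) (q t : R) (a b : nat) :
  expR ((a%:R * q - b%:R) * t) = expR (q * t) ^+ a / expR t ^+ b.
Proof. by rewrite mulrBl -mulrA expRD expRN !expRM_natl. Qed.

Lemma expR_linBC (R : realType) (q t : R) (a b : nat) :
  expR ((b%:R - a%:R * q) * t) = expR t ^+ b / expR (q * t) ^+ a.
Proof. by rewrite mulrBl -mulrA expRD expRN !expRM_natl. Qed.

Lemma expR_linN (R : realType) (c t : R) (a : nat) :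
  expR (- (a%:R * c) * t) = expR (c * t) ^- a.
Proof. by rewrite mulNr expRN -mulrA expRM_natl. Qed.

(* Turns every exponential into a monomial in [P = exp t] and [Q = exp (q t)],
   where the identity is one between rational functions. *)
Ltac wronskian_identity t q terms :=
  rewrite /wronskian expsum_odd_part /expsum /terms /=;
  rewrite !(big_cons, big_nil) /=;
  rewrite !expRN !(expR_linD, expR_linB, expR_linBC, expR_linN) (mul1r t);
  have := expR_gt0 t; have := expR_gt0 (q * t);
  move: (expR t) (expR (q * t)) => P Q Q0 P0;
  field; rewrite !gt_eqF.

(** These lists come from expanding [B' A - q A' B]: the product of [z ^+ i] and
[(z `^ q) ^+ j] has coefficient [2 q b_j (i - j)], with [b_j] the coefficients
1, 2, ..., 2, 1 of [(1 + u) * G s u]. Since [b] is palindromic, the terms for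
(i, j) and (s + 1 - i, s + 1 - j) are opposite, and they pair up into a
hyperbolic sine once the middle monomial is factored out. The coefficients are
written so that all frequencies are positive, and the numerals 0 and 1 are kept
so that every frequency has the same shape. *)
Definition sinh_terms1 (R : realType) (q : R) : seq (R * R) :=
  [:: (1, 2%:R * q + 0%:R); (2, 2%:R * q - 2%:R); (-2, 2%:R - 0%:R * q)].

Lemma wronskian1E (R : realType) (q t : R) : wronskian q 1 t =
  2 * q * (expR (q * t) * expR t) ^- 2 * expsum (odd_part (sinh_terms1 q)) 0 t.
Proof. by wronskian_identity t q sinh_terms1. Qed.

Definition sinh_terms2 (R : realType) (q : R) : seq (R * R) :=
  [:: (1, 3%:R * q + 1%:R); (2, 3%:R * q - 1%:R); (3, 3%:R * q - 3%:R);
      (2, 1%:R * q - 1%:R); (-4, 3%:R - 1%:R * q); (-2, 1%:R * q + 3%:R)].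

Lemma wronskian2E (R : realType) (q t : R) : wronskian q 2 t =
  2 * q * (expR (q * t) * expR t) ^- 3 * expsum (odd_part (sinh_terms2 q)) 0 t.
Proof. by wronskian_identity t q sinh_terms2. Qed.

Definition sinh_terms3 (R : realType) (q : R) : seq (R * R) :=
  [:: (1, 4%:R * q + 2%:R); (2, 4%:R * q + 0%:R); (3, 4%:R * q - 2%:R);
      (4, 4%:R * q - 4%:R); (2, 2%:R * q + 0%:R); (4, 2%:R * q - 2%:R);
      (-2, 2%:R - 0%:R * q); (-4, 4%:R - 0%:R * q); (-2, 2%:R * q + 4%:R);
      (-6, 4%:R - 2%:R * q)].

Lemma wronskian3E (R : realType) (q t : R) : wronskian q 3 t =
  2 * q * (expR (q * t) * expR t) ^- 4 * expsum (odd_part (sinh_terms3 q)) 0 t.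
Proof. by wronskian_identity t q sinh_terms3. Qed.

(** * Moments of the three lists *)

Lemma lerX_bounds (R : realType) (a b y : R) m : 0 <= a -> a <= y <= b ->
  a ^+ m <= y ^+ m <= b ^+ m.
Proof.
move=> a0 /andP[ay yb].
by rewrite !lerXn2r ?nnegrE // (le_trans a0) // (le_trans ay).
Qed.

(* Encloses the power [y ^+ m] and forgets what [y] is, so that the final
   inequality is linear in the powers. *)
Ltac bound_power y a b m :=
  have /andP[] : a ^+ m <= y ^+ m <= b ^+ m
    by [apply: lerX_bounds; lra];
  move: (y ^+ m).

(** The first moment is negative, and from order 3 on the frequency [2 q]
dominates because [q ^+ 3 >= 2]. *)
Lemma stays_positive_sinh1 (R : realType) (q : R) : 84 / 65 <= q <= 22 / 17 ->
  stays_positive (expsum (odd_part (sinh_terms1 q)) 0).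
Proof.
case/andP=> q_ge q_le; apply: stays_positive_step => //.
  by rewrite /moment !(big_cons, big_nil) /=; lra.
apply: stays_positive_ge0.
apply: (dominated_ge0 (pos := [:: _]) (neg := [:: _])) => //=; first lra.
- by rewrite andbT mulr_ge0 ?exprn_ge0 //; lra.
- by rewrite ger0_norm mul0r subr0 // !andbT; apply/andP; split; lra.
rewrite /moment !(big_cons, big_nil) /= mul0r subr0.
have /andP[+ _] : (168 / 65 : R) ^+ 3 <= (2 * q + 0) ^+ 3 <= (44 / 17) ^+ 3.
  by apply: lerX_bounds; lra.
lra.
Qed.

(* The bounds are the values of the frequencies at [84 / 65] and [22 / 17]. *)
Ltac bound_moment2 R q m :=
  rewrite /moment !(big_cons, big_nil) /=;
  bound_power (3 * q + 1%:R) (317 / 65 : R) (83 / 17 : R) m;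
  bound_power (3 * q - 1%:R) (187 / 65 : R) (49 / 17 : R) m;
  bound_power (3 * q - 3) (57 / 65 : R) (15 / 17 : R) m;
  bound_power (1%:R * q - 1%:R) (19 / 65 : R) (5 / 17 : R) m;
  bound_power (3 - 1%:R * q) (29 / 17 : R) (111 / 65 : R) m;
  bound_power (1%:R * q + 3) (279 / 65 : R) (73 / 17 : R) m;
  by move=> *; lra.

(** The moments of order 1 and 3 are negative, that of order 5 is positive, and
from order 7 on the largest frequency [3 q + 1] dominates. *)
Lemma stays_positive_sinh2 (R : realType) (q : R) : 84 / 65 <= q <= 22 / 17 ->
  stays_positive (expsum (odd_part (sinh_terms2 q)) 0).
Proof.
case/andP=> q_ge q_le; apply: stays_positive_step => //.
  bound_moment2 R q 1%N.
apply: stays_positive_step => //.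
  bound_moment2 R q 3%N.
apply: stays_positive_ge0; apply: ge0_step => //.
  bound_moment2 R q 5%N.
apply: (dominated_ge0 (pos := [:: _; _; _]) (neg := [:: _; _])) => //=.
- lra.
- by rewrite !andbT !mulr_ge0 ?exprn_ge0 //; lra.
- rewrite !andbT !ger0_norm; [|lra|lra].
  by do !(apply/andP; split); rewrite ?mulr_le0_ge0 ?exprn_ge0 //; lra.
rewrite /moment !(big_cons, big_nil) /=.
bound_power (3 * q + 1%:R) (317 / 65 : R) (83 / 17 : R) 7%N.
bound_power (3 - 1%:R * q) (29 / 17 : R) (111 / 65 : R) 7%N.
bound_power (1%:R * q + 3) (279 / 65 : R) (73 / 17 : R) 7%N.
by move=> *; lra.
Qed.


Ltac bound_moment3 R q m :=
  rewrite /moment !(big_cons, big_nil) /=;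
  bound_power (4 * q + 2) (466 / 65 : R) (122 / 17 : R) m;
  bound_power (4 * q + 0) (336 / 65 : R) (88 / 17 : R) m;
  bound_power (4 * q - 2) (206 / 65 : R) (54 / 17 : R) m;
  bound_power (4 * q - 4) (76 / 65 : R) (20 / 17 : R) m;
  bound_power (2 * q + 0) (168 / 65 : R) (44 / 17 : R) m;
  bound_power (2 * q - 2) (38 / 65 : R) (10 / 17 : R) m;
  bound_power (2 - 0 * q) (2 : R) (2 : R) m;
  bound_power (4 - 0 * q) (4 : R) (4 : R) m;
  bound_power (2 * q + 4) (428 / 65 : R) (112 / 17 : R) m;
  bound_power (4 - 2 * q) (24 / 17 : R) (92 / 65 : R) m;
  by move=> *; lra.

(** The moments of order 1, 3 and 5 are negative, that of order 7 is positive,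
and from order 9 on the largest frequency [4 q + 2] dominates. *)
Lemma stays_positive_sinh3 (R : realType) (q : R) : 84 / 65 <= q <= 22 / 17 ->
  stays_positive (expsum (odd_part (sinh_terms3 q)) 0).
Proof.
case/andP=> q_ge q_le; apply: stays_positive_step => //.
  bound_moment3 R q 1%N.
apply: stays_positive_step => //.
  bound_moment3 R q 3%N.
apply: stays_positive_step => //.
  bound_moment3 R q 5%N.
apply: stays_positive_ge0; apply: ge0_step => //.
  bound_moment3 R q 7%N.
apply: (dominated_ge0 (pos := [:: _; _; _; _; _])
  (neg := [:: _; _; _; _])) => //=.
- lra.
- by rewrite !andbT !mulr_ge0 ?exprn_ge0 //; lra.
- rewrite !andbT !ger0_norm; [|lra..].
  by do !(apply/andP; split); rewrite ?mulr_le0_ge0 ?exprn_ge0 //; lra.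
rewrite /moment !(big_cons, big_nil) /=.
bound_power (4 * q + 2) (466 / 65 : R) (122 / 17 : R) 9%N.
bound_power (2 - 0 * q) (2 : R) (2 : R) 9%N.
bound_power (4 - 0 * q) (4 : R) (4 : R) 9%N.
bound_power (2 * q + 4) (428 / 65 : R) (112 / 17 : R) 9%N.
bound_power (4 - 2 * q) (24 / 17 : R) (92 / 65 : R) 9%N.
by move=> *; lra.
Qed.

(** * Induction for s >= 3 *)

(** The graph of the convex function [y `^ q] lies above its tangent at [a]. *)
Lemma powR_tangent (R : realType) (q a d : R) : 1 <= q -> 0 < a -> 0 <= d ->
  a `^ q + q * d * a `^ (q - 1) <= (a + d) `^ q.
Proof.
move=> q1 a0 d0; have ad : a <= a + d by rewrite lerDl.
have powd (y : R) : 0 < y -> is_derive y 1 (@powR R ^~ q) (q * y `^ (q - 1)).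
  exact: is_derive1_powR.
have powc : {within `[a, a + d], continuous (@powR R ^~ q)}.
  apply: derivable_within_continuous => y; rewrite in_itv /= => /andP[ay _].
  by case: (powd y (lt_le_trans a0 ay)).
have powd' y : y \in `]a, a + d[ ->
    is_derive y 1 (@powR R ^~ q) (q * y `^ (q - 1)).
  by rewrite in_itv /= => /andP[ay _]; exact: powd (lt_trans a0 ay).
have [c] := MVT_segment ad powd' powc.
rewrite in_itv /= => /andP[ac _] E.
have : q * d * a `^ (q - 1) <= q * d * c `^ (q - 1).
  rewrite ler_wpM2l ?mulr_ge0 //; first lra.
  by rewrite ge0_ler_powR ?nnegrE ?subr_ge0 // ltW // (lt_le_trans a0).
by lra.
Qed.

Lemma GS (R : realType) n (t : R) : G n.+1 t = G n t + t ^+ n.+1.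
Proof. by rewrite /G big_nat_recr. Qed.

Lemma G_ge_last5 (R : realType) m (z : R) : 0 <= z ->
  z ^+ m * (1 + z + z ^+ 2 + z ^+ 3 + z ^+ 4) <= G m.+4 z.
Proof.
move=> z0; have : z ^+ m <= G m z.
  by rewrite /G big_nat_recr //= lerDr sumr_ge0 // => i _; exact: exprn_ge0.
by rewrite !GS !exprS; lra.
Qed.

Lemma product_bound0 (R : realType) (q : R) : 1 <= q -> product_bound q 0.
Proof.
move=> q1 z /andP[z0 z1].
have := powR_tangent q1 ltr01 (ltW z0); rewrite !powR1 mulr1.
rewrite GS [G 0 z]big_nat1 [G 0 _]big_nat1 !expr0 expr1 mulr1.
apply: le_trans; rewrite lerD2l; apply: (@le_trans _ _ z).
  by rewrite ge1r_powR ?z0.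
by rewrite ler_peMl // ltW.
Qed.

(** With [r = z `^ ((q - 1) / 2)] one has [z >= r ^+ 7], because [q >= 9 / 7].
The sum [G m.+4 z] is at least [5 z ^+ m.+2], by the arithmetic-geometric inequality
on its last five terms, and also at least [z ^+ m]. The first estimate is sharp
at [z = 1] and suffices for [r >= 9 / 10], the second one suffices for smaller
[r]. *)
Lemma increment_bound (R : realType) (q : R) m (z : R) :
  9 / 7 <= q -> 2 <= q * 5 `^ (q - 1) -> 0 < z <= 1 ->
  (1 + z `^ q) * (z ^+ m.+4) `^ (q - 1) <= q * z * G m.+4 z `^ (q - 1).
Proof.
move=> q97 q5 /andP[z0 z1]; set e := q - 1.
have e0 : 0 <= e by rewrite /e; lra.
have qz0 : 0 <= q * z by rewrite mulr_ge0 ?(ltW z0) //; lra.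
pose r := z `^ (e / 2); have r0 : 0 < r by exact: powR_gt0.
have ze : z `^ e = r ^+ 2.
  by rewrite -powR_mulrn ?ltW // -powRrM; congr powR; field.
have zq : z `^ q = z * r ^+ 2 by rewrite -ze mulr_powRB1 ?ltW //; lra.
have zXe k : (z ^+ k) `^ e = r ^+ (2 * k).
  by rewrite -powR_mulrn ?ltW // powRAC ze powR_mulrn ?exprn_ge0 ?ltW // exprM.
have r1 : r <= 1.
  rewrite -[leRHS](congr1 (@^~ (e / 2)) (@powR1 R)).
  by apply: ge0_ler_powR; rewrite ?nnegrE ?divr_ge0 // ltW.
have r7 : r ^+ 7 <= z.
  rewrite -powR_mulrn ?(ltW r0) // -powRrM ge1r_powR ?z0 //.
  by rewrite /e; lra.
rewrite zXe zq.
have Gge := G_ge_last5 m (ltW z0).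
have [r9|r9] := leP (9 / 10) r.
  have G5 : 5 * z ^+ m.+2 <= G m.+4 z.
    apply: le_trans Gge; rewrite 2!exprS.
    have : 0 <= z ^+ m * ((1 - z ^+ 2) ^+ 2 + z * (1 - z) ^+ 2).
      rewrite mulr_ge0 ?exprn_ge0 ?(ltW z0) // addr_ge0 ?sqr_ge0 //.
      by rewrite mulr_ge0 ?sqr_ge0 // ltW.
    by lra.
  have Ge5 : 5 `^ e * r ^+ (2 * m.+2) <= G m.+4 z `^ e.
    rewrite -zXe -powRM ?exprn_ge0 ?(ltW z0) //.
    apply: ge0_ler_powR; rewrite ?nnegrE //.
      by rewrite mulr_ge0 // exprn_ge0 // ltW.
    by rewrite ltW // G_gt0 // ltW.
  (* With [z = r ^+ 7] the claim is [1 <= r ^+ 3 * (2 - r ^+ 6)], a cubic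
     inequality in [r ^+ 3] that holds between [(sqrt 5 - 1) / 2] and 1. *)
  have key : (1 + z * r ^+ 2) * r ^+ 4 <= 2 * z.
    have r34 : 0 <= (1 - r ^+ 3) * (r ^+ 6 + r ^+ 3 - 1).
      apply: mulr_ge0; first by rewrite subr_ge0 exprn_ile1 // ltW.
      have : (9 / 10) ^+ 3 <= r ^+ 3 by apply: lerXn2r; rewrite ?nnegrE; lra.
      have : (9 / 10) ^+ 6 <= r ^+ 6 by apply: lerXn2r; rewrite ?nnegrE; lra.
      by lra.
    have r61 : r ^+ 6 <= 1 by rewrite exprn_ile1 // ltW.
    have : 0 <= (z - r ^+ 7) * (2 - r ^+ 6) by apply: mulr_ge0; lra.
    have : 0 <= r ^+ 4 * ((1 - r ^+ 3) * (r ^+ 6 + r ^+ 3 - 1)).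
      by rewrite mulr_ge0 // exprn_ge0 // ltW.
    by lra.
  have rm0 : 0 < r ^+ (2 * m.+2) by exact: exprn_gt0.
  apply: le_trans (ler_wpM2l qz0 Ge5).
  have -> : r ^+ (2 * m.+4) = r ^+ 4 * r ^+ (2 * m.+2).
    by rewrite -exprD; congr (r ^+ _); rewrite !mulnS.
  rewrite (mulrA (1 + _)) (mulrA (q * z)) (ler_pM2r rm0); apply: (le_trans key).
  by rewrite (mulrAC q) (ler_pM2r z0).
have Ge1 : r ^+ (2 * m) <= G m.+4 z `^ e.
  rewrite -zXe; apply: ge0_ler_powR; rewrite ?nnegrE ?exprn_ge0 ?(ltW z0) //.
    by rewrite ltW // G_gt0 // ltW.
  apply: le_trans Gge; rewrite ler_peMr ?exprn_ge0 ?(ltW z0) //.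
  by rewrite -!addrA lerDl !addr_ge0 // ?exprn_ge0 // ltW.
(* Here [z = r ^+ 7] leaves [r + r ^+ 10 <= q]. *)
have key : (1 + z * r ^+ 2) * r ^+ 8 <= q * z.
  have r10 : r ^+ 10 <= (9 / 10) ^+ 10.
    by apply: lerXn2r; rewrite ?nnegrE; lra.
  have : 0 <= (q - r - r ^+ 10) * z by apply: mulr_ge0; lra.
  have : 0 <= (z - r ^+ 7) * r by apply: mulr_ge0; lra.
  by lra.
apply: le_trans (ler_wpM2l qz0 Ge1).
have -> : r ^+ (2 * m.+4) = r ^+ 8 * r ^+ (2 * m).
  by rewrite -exprD; congr (r ^+ _); rewrite !mulnS.
by rewrite (mulrA (1 + _)) (ler_pM2r (exprn_gt0 _ r0)).
Qed.

Lemma product_bound_step (R : realType) (q : R) m :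
  9 / 7 <= q -> 2 <= q * 5 `^ (q - 1) ->
  product_bound q m.+3 -> product_bound q m.+4.
Proof.
move=> q97 q5 IH z z01; have /andP[z0 z1] := z01.
rewrite GS mulrDr (GS m.+4 z).
have A0 : 0 < G m.+4 z by rewrite G_gt0 // ltW.
have q1 : 1 <= q by lra.
apply: le_trans (powR_tangent q1 A0 (exprn_ge0 _ (ltW z0))).
apply: lerD; first exact: IH.
have y0 : 0 <= z ^+ m.+4 by rewrite exprn_ge0 // ltW.
have -> : (z `^ q) ^+ m.+4 = (z ^+ m.+4) `^ (q - 1) * z ^+ m.+4.
  rewrite mulrC mulr_powRB1 //; last lra.
  by rewrite -(powR_mulrn _ (powR_ge0 _ _)) -(powR_mulrn _ (ltW z0)) powRAC.
have := ler_wpM2r y0 (increment_bound m q97 q5 z01).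
rewrite (exprS z m.+4); move: (z ^+ m.+4) (G m.+4 z `^ _) => y A.
by rewrite (mulrA (1 + _)) (mulrAC _ A) (mulrA q).
Qed.

(** * The exponent ln 6 / ln 4 *)

Lemma ln_le_of_pow (R : realType) (a b : R) m k : 0 < a -> 0 < b ->
  a ^+ m <= b ^+ k -> m%:R * ln a <= k%:R * ln b.
Proof.
by move=> a0 b0 ab; rewrite !mulr_natl -!lnXn // ler_ln ?posrE ?exprn_gt0.
Qed.

Lemma powR_ge_of_pow (R : realType) (a b q : R) m k : 1 <= a -> 0 < b ->
  (0 < k)%N -> m%:R / k%:R <= q -> b ^+ k <= a ^+ m -> b <= a `^ q.
Proof.
move=> a1 b0 k0 mkq bam; have a0 := lt_le_trans ltr01 a1.
rewrite -ler_ln ?posrE ?powR_gt0 // ln_powR.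
have := ln_le_of_pow b0 a0 bam.
rewrite -ler_pdivlMl ?ltr0n // mulrCA mulrA => /le_trans; apply.
by rewrite ler_wpM2r ?ln_ge0.
Qed.

(** Equivalent to [4 ^+ 84 <= 6 ^+ 65] and [6 ^+ 17 <= 4 ^+ 22]. The lower bound
has to be this close: the case [s = 3] needs [8 <= 5 `^ q], so
[q >= ln 8 / ln 5], which is less than [5 * 10^-4] below [q]. *)
Lemma exponent_bounds (R : realType) : 84 / 65 <= (ln 6 / ln 4 : R) <= 22 / 17.
Proof.
have l4 : 0 < ln 4 :> R by rewrite ln_gt0 ?ltr1n.
have h1 : 84%:R * ln 4 <= 65%:R * ln 6 :> R by apply: ln_le_of_pow; lra.
have h2 : 17%:R * ln 6 <= 22%:R * ln 4 :> R by apply: ln_le_of_pow; lra.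
by rewrite ler_pdivlMr // ler_pdivrMr //; apply/andP; split; lra.
Qed.

Lemma product_bound_exponent (R : realType) s :
  product_bound (ln 6 / ln 4 : R) s.
Proof.
have /andP[q_ge q_le] := exponent_bounds R.
have l4 : 0 < ln 4 :> R by rewrite ln_gt0 ?ltr1n.
have q4 : 4 `^ (ln 6 / ln 4) = 6 :> R.
  by rewrite /powR gt_eqF // divfK ?gt_eqF // lnK // posrE.
move: (ln 6 / ln 4) q_ge q_le q4 => q q_ge q_le q4.
have q_in : 84 / 65 <= q <= 22 / 17 by rewrite q_ge.
have q0 : 0 < q by lra.
have q1 : 1 < q by lra.
case: s => [|[|[|s]]].
- by apply: product_bound0; lra.
- apply: product_le_powR => //.
    rewrite -natrM.
    by apply: (@powR_ge_of_pow _ _ _ _ 9 7) => //; lra.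
  apply: (stays_positive_wronskian q0 (wronskian1E q)).
  exact: stays_positive_sinh1.
- apply: product_le_powR => //; first by rewrite q4; lra.
  apply: (stays_positive_wronskian q0 (wronskian2E q)).
  exact: stays_positive_sinh2.
have q5 : 2 <= q * 5 `^ (q - 1).
  have : 14 / 9 <= 5 `^ (q - 1) :> R.
    by apply: (@powR_ge_of_pow _ _ _ _ 2 7) => //; lra.
  have : 0 <= (q - 9 / 7) * 5 `^ (q - 1).
    by rewrite mulr_ge0 ?powR_ge0 //; lra.
  by lra.
(* The base case is [s = 3]: the induction step starts there. *)
elim: s => [|s IH]; last by apply: product_bound_step => //; lra.
apply: product_le_powR => //.
  by rewrite -natrM; apply: (@powR_ge_of_pow _ _ _ _ 84 65) => //; lra.
apply: (stays_positive_wronskian q0 (wronskian3E q)).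
exact: stays_positive_sinh3.
Qed.

(** * The largest exponents *)

Lemma G_product_le (R : realType) (L : nat) (t : R) : 0 <= t <= 1 ->
  ((1 + t) * G L t) `^ (ln 4 / ln 6) <= G L.+1 (t `^ (ln 4 / ln 6)).
Proof.
have l4 : 0 < ln 4 :> R by rewrite ln_gt0 ?ltr1n.
have l6 : 0 < ln 6 :> R by rewrite ln_gt0 ?ltr1n.
have p0 : 0 < ln 4 / ln 6 :> R by rewrite divr_gt0.
case/andP; rewrite le_eqVlt => /predU1P[<- _|t0 t1].
  rewrite [G L 0](_ : _ = 1) ?addr0 ?mul1r ?powR1.
    by rewrite G_ge1 // powR_ge0.
  rewrite /G big_nat_recl // big1 ?addr0 // => i _.
  by rewrite exprS mul0r.
set p := _ / _; pose z := t `^ p.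
have zq : z `^ (ln 6 / ln 4) = t.
  rewrite -powRrM (_ : p * _ = 1) ?powRr1 ?ltW //.
  by rewrite /p mulrA divfK ?divff ?gt_eqF.
have z0 : 0 < z by exact: powR_gt0.
have z1 : z <= 1.
  rewrite -[leRHS](congr1 (@^~ p) (@powR1 R)).
  by apply: ge0_ler_powR; rewrite ?nnegrE ?ler01 // ltW.
have := @product_bound_exponent R L z; rewrite zq z0 z1 => /(_ isT) bound.
have Gz : 0 <= G L.+1 z by rewrite ltW // G_gt0 // ltW.
have Gt : 0 <= (1 + t) * G L t.
  by rewrite mulr_ge0 // ltW ?addr_gt0 ?G_gt0 // ltW.
rewrite [leRHS](_ : _ = (G L.+1 z `^ (ln 6 / ln 4)) `^ p); last first.
  rewrite -powRrM (_ : _ * p = 1) ?powRr1 //.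
  by rewrite /p mulrA divfK ?divff ?gt_eqF.
by apply: ge0_ler_powR; rewrite ?nnegrE ?powR_ge0 // ltW.
Qed.

Lemma admissible_1 (R : realType) s : admissible 1 s (ln 4 / ln 6 : R).
Proof.
right; split=> [|t t01]; first by rewrite divr_gt0 ?ln_gt0 ?ltr1n.
have /andP[t0 _] := t01.
have -> : G 1 t = 1 + t by rewrite GS /G big_nat1 expr0 expr1.
rewrite -powRM ?addr_ge0 // ?add1n; first exact: G_product_le.
by rewrite ltW // G_gt0.
Qed.

(** At [t = 1] admissibility for (1, 2) reads [6 `^ p <= 4]. *)
Lemma admissible_12_le (R : realType) (p : R) :
  admissible 1 2 p -> p <= ln 4 / ln 6.
Proof.
have l6 : 0 < ln 6 :> R by rewrite ln_gt0 ?ltr1n.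
case=> [->|[p0 /(_ 1)]]; first by rewrite divr_ge0 ?ln_ge0 ?ler1n.
rewrite ler01 lexx powR1 !G1 -powRM // -natrM => /(_ isT) le4.
by rewrite ler_pdivlMr // -ln_powR ler_ln ?posrE ?powR_gt0.
Qed.

Theorem corollary1p3 (R : realType) :
  let C1 : R := inf [set largest_exponent R 1 s | s in [set s : nat | (1 <= s)%N]] in
  let p0 : R := ln 4 / ln 6 in
  [/\ C1 = largest_exponent R 1 2,
      largest_exponent R 1 2 = p0 &
      forall (L : nat) (t : R), 0 <= t <= 1 ->
        ((1 + t) * G L t) `^ p0 <= G L.+1 (t `^ p0)].
Proof.
move=> C1 p0.
have p0_le s : (0 < s)%N -> p0 <= largest_exponent R 1 s.
  by move=> s0; apply: (largest_exponentP R _ s0).2 => //; exact: admissible_1.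
have p12 : largest_exponent R 1 2 = p0.
  apply/eqP; rewrite eq_le p0_le // andbT.
  by apply: admissible_12_le; exact: (largest_exponentP R _ _).1.
split=> //; last exact: G_product_le.
have lb_p0 : lbound [set largest_exponent R 1 s | s in [set s | (1 <= s)%N]] p0.
  by move=> _ [s /= s1 <-]; exact: p0_le.
apply/eqP; rewrite eq_le; apply/andP; split.
  by apply: ge_inf; [exists p0|exists 2%N].
rewrite p12; apply: lb_le_inf => //.
by exists (largest_exponent R 1 1); exists 1%N.
Qed.
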